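(* There exists a countable regular Whyburn space which is not selectively separable.
   Context: Regular spaces are assumed to be $T_1$. $X$ is selectively separable if for every sequence $(D_n:n\in\omega)$ of dense subspaces of $X$ one can pick finite sets $F_n\subset D_n$ so that $\bigcup_{n\in\omega}F_n$ is dense in $X$. $X$ has the Whyburn property (is a Whyburn space) if for every $A\subset X$ and every $p\in\overline A\setminus A$ there exists $B\subset A$ such that $\overline B=B\cup\{p\}$. *)

(* Defs.v *)
From mathcomp Require Import all_boot.
From mathcomp Require Import boolp classical_sets cardinality topology.

Set Implicit Arguments.
Unset Strict Implicit.
Unset Printing Implicit Defensive.

Local Open Scope classical_set_scope.

Definition selectively_separable (X : topologicalType) : Prop :=
  forall D : nat -> set X, (forall n, dense (D n)) ->
  exists F : nat -> set X,
    (forall n, finite_set (F n) /\ F n `<=` D n) /\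
    dense (\bigcup_n F n).

Definition whyburn_space (X : topologicalType) : Prop :=
  forall (A : set X) (p : X), (closure A `\` A) p ->
  exists B : set X, B `<=` A /\ closure B = B `|` [set p].

(* The library's [regular_space] does not include the T1 axiom
   ([accessible_space]). *)
Definition regular_T1_space (X : topologicalType) : Prop :=
  accessible_space X /\ regular_space X.

(* Main.v *)
Require Import Defs.
From HB Require Import structures.
From mathcomp Require Import all_boot.
From mathcomp Require Import boolp classical_sets cardinality topology.

(**
A regular space in which every set with empty interior is closed is Whyburn:
for [p] in [closure A `\` A], the set [closure A `\` A] minus [p] has empty
interior, so [p] has a closed neighbourhood [V] missing it, and
[B = A `&` V] works.

Let [E (A, x)] be a family of subsets of a countable set [X], indexed by all
[A : set X] and [x : X], and independent modulo an ideal [I0]. Let [I] be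
maximal among the ideals containing [I0] modulo which [E] is still
independent. For [A] in [I], replace [E (A, x)] by [E (A, x)] minus [A] plus
[x], and declare all these sets clopen. Every [A] in [I] is then closed. The
sets have changed only by elements of [I], so nonempty basic sets are not in
[I], and by maximality of [I] every set outside [I] contains one of them
modulo [I]: the sets with empty interior are exactly those in [I].

If [X] is fibred over [nat] and [I0] contains each fibre and each set meeting
every fibre in a finite set, then the complements of the unions of the first
[n] fibres are dense, while a union of finite selections from them is in [I],
hence is not dense.
*)

Set Implicit Arguments.
Unset Strict Implicit.
Unset Printing Implicit Defensive.

Local Open Scope classical_set_scope.

(** * A criterion for the Whyburn property *)

Lemma whyburn_of_closed_empty_interior (X : topologicalType) :
  regular_space X -> (forall A : set X, A° = set0 -> closed A) ->
  whyburn_space X.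
Proof.
move=> regX clX A p [clAp nAp].
pose N := (closure A `\` A) `\ p.
have N0 : N° = set0.
  apply/seteqP; split=> // x /= Nx.
  have [[clAx _] _] := nbhs_singleton Nx.
  by have [y [Ay [[_ ]]]] := clAx _ Nx.
have Np : nbhs p (~` N).
  by apply: open_nbhs_nbhs; split; [apply: closed_openC; exact: clX|move=> [_ /(_ erefl)]].
have [U Up UN] := regX p _ Np.
exists (A `&` closure U); split; first by move=> x [].
apply/seteqP; split=> [y clBy|y [By|->]].
- have clAy : closure A y by apply: closureS clBy => z [].
  have clUy : closure U y by apply: closed_closure; apply: closureS clBy => z [].
  have [Ay|nAy] := pselect (A y); first by left.
  by right; apply: contrapT => yp; apply: (UN y clUy).
- exact: subset_closure.
- move=> V Vp; have [z [Az [Uz Vz]]] := clAp _ (filterI Up Vp).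
  by exists z; split=> //; split=> //; exact: subset_closure.
Qed.

(** * Ideals maximal for independence *)

Definition cell (T : Type) (J : eqType) (F : J -> set T) (g : set J)
    (K : seq J) : set T :=
  [set y | forall j, j \in K -> F j y = g j].

Definition is_ideal (T : Type) (I : set (set T)) : Prop :=
  [/\ I set0, (forall A B, A `<=` B -> I B -> I A)
    & forall A B, I A -> I B -> I (A `|` B)].

(** As the signs form a function [g], repetitions in [K] never impose contradictory conditions. *)
Definition independent_mod (T : Type) (J : eqType) (F : J -> set T)
    (I : set (set T)) : Prop :=
  forall g K, ~ I (cell F g K).

Lemma maximal_independence_ideal (T : Type) (J : eqType) (F : J -> set T)
    (I0 : set (set T)) :
  is_ideal I0 -> independent_mod F I0 ->
  exists I, [/\ I0 `<=` I, is_ideal I, independent_mod F I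
    & forall N, ~ I N -> exists g K, I (cell F g K `\` N)].
Proof.
move=> [I00 I0S I0U] indI0.
(* The union with [I0] makes the empty family admissible in Zorn's lemma. *)
pose P := [set M | is_ideal (M `|` I0) /\ independent_mod F (M `|` I0)].
have [C CP Ctot|M [[idM indM] maxM]] := @Zorn_bigcup _ P.
  have sub M : C M -> M `<=` \bigcup_(X in C) X by move=> CM A MA; exists M.
  have lift M A : C M -> (M `|` I0) A -> (\bigcup_(X in C) X `|` I0) A.
    by move=> CM [/(sub _ CM)|]; [left|right].
  split; first split.
  - by right.
  - move=> A B AB [[M CM MB]|I0B]; last by right; exact: I0S I0B.
    have [[_ MS _] _] := CP _ CM.
    by apply: (lift M) => //; apply: MS AB _; left.
  - move=> A B [[M CM MA]|I0A] [[L CL LB]|I0B].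
    + have [ML|LM] := Ctot _ _ CM CL.
        have [[_ _ LU] _] := CP _ CL.
        by apply: (lift L) => //; apply: LU; left => //; exact: ML.
      have [[_ _ MU] _] := CP _ CM.
      by apply: (lift M) => //; apply: MU; left => //; exact: LM.
    + have [[_ _ MU] _] := CP _ CM.
      by apply: (lift M) => //; apply: MU; [left|right].
    + have [[_ _ LU] _] := CP _ CL.
      by apply: (lift L) => //; apply: LU; [right|left].
    + by right; exact: I0U.
  - move=> g K [[M CM MK]|]; last exact: indI0.
    by have [_ indM] := CP _ CM; apply: (indM g K); left.
exists (M `|` I0); split=> // N nIN.
apply: contrapT => noK.
have [I0' IS IU] := idM.
(* The ideal generated by [N] and the maximal one. It stays independent because no cell lies in [N]
   modulo the latter. *)
pose M' := [set A | (M `|` I0) (A `\` N)].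
have MM' A : (M `|` I0) A -> M' A by apply: IS => x [].
have M'E : M' `|` I0 = M'.
  by apply/seteqP; split=> A; [case=> // I0A; apply: MM'; right|left].
apply: (maxM M').
  split=> [A MA|M'M]; first by apply: MM'; left.
  by apply: nIN; left; apply: M'M; rewrite /M' /= setDv.
rewrite /P /= M'E; split; first split.
- exact: MM'.
- by move=> A B AB; apply: IS; exact: setSD.
- by move=> A B M'A M'B; rewrite /M' /= setDUl; exact: IU.
- by move=> g K M'K; apply: noK; exists g, K.
Qed.

(** * The topology generated by a family and its complements *)

Definition clopen_space (T : choiceType) (J : eqType) (F : J -> set T) : Type :=
  T.

Section ClopenSpace.
Context (T : choiceType) (J : eqType) (F : J -> set T).

(** [cell F (F^~ x) K] is the cell over [K] through [x]; these cells form a neighbourhood base at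
    [x]. *)
Definition clopen_space_open : set (set (clopen_space F)) :=
  [set U | forall x, U x -> exists K, cell F (F^~ x) K `<=` U].

Lemma clopen_space_openT : clopen_space_open setT.
Proof. by move=> x _; exists [::]. Qed.

Lemma clopen_space_openI : setI_closed clopen_space_open.
Proof.
move=> U V oU oV x [/oU[K KU] /oV[L LV]]; exists (K ++ L) => y KLy; split.
  by apply: KU => j jK; apply: KLy; rewrite mem_cat jK.
by apply: LV => j jL; apply: KLy; rewrite mem_cat jL orbT.
Qed.

Lemma clopen_space_open_bigcup (I : Type) (f : I -> set (clopen_space F)) :
  (forall i, clopen_space_open (f i)) -> clopen_space_open (\bigcup_i f i).
Proof.
by move=> of_ x [i _ /of_[K Kf]]; exists K => y /Kf fy; exists i.
Qed.

HB.instance Definition _ := Choice.copy (clopen_space F) T.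
HB.instance Definition _ := isOpenTopological.Build (clopen_space F)
  clopen_space_openT clopen_space_openI clopen_space_open_bigcup.

Local Notation X := (clopen_space F).

Lemma open_cell g K : open (cell F g K : set X).
Proof. by move=> x Kx; exists K => y Ky j jK; rewrite Ky// Kx. Qed.

Lemma closed_cell g K : closed (cell F g K : set X).
Proof.
move=> x clx j jK.
have [|y [Ky /(_ _ jK) <-]] := clx (cell F (F^~ x) K); last exact: Ky.
by apply: open_nbhs_nbhs; split; first exact: open_cell.
Qed.

Lemma open_generator j : open (F j : set X).
Proof.
move=> x Fjx; exists [:: j] => y /(_ j); rewrite inE eqxx => /(_ isT).
by move->.
Qed.

Lemma nbhs_cell (x : X) (A : set X) :
  nbhs x A -> exists K, cell F (F^~ x) K `<=` A.
Proof.
rewrite nbhsE => -[U [oU Ux] UA].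
by have [K KU] := oU x Ux; exists K; exact: subset_trans UA.
Qed.

Lemma clopen_space_regular : regular_space X.
Proof.
move=> a A /nbhs_cell[K KA]; exists (cell F (F^~ a) K).
  by apply: open_nbhs_nbhs; split; first exact: open_cell.
by rewrite -(closure_id _).1//; exact: closed_cell.
Qed.

End ClopenSpace.

(** * Modifying the family to make the ideal closed *)

Section ClosedIdeal.
Context (T : choiceType) (E : set T * T -> set T) (I : set (set T)).
Hypotheses (I_ideal : is_ideal I) (I_set1 : forall x, I [set x]).
Hypothesis E_indep : independent_mod E I.
Hypothesis I_max : forall N, ~ I N -> exists g K, I (cell E g K `\` N).

Definition closing_family (j : set T * T) : set T :=
  [set y | if `[< I j.1 >] then y = j.2 \/ E j y /\ ~ j.1 y else E j y].

Local Notation X := (clopen_space closing_family).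

Lemma closing_family_modI (K : seq (set T * T)) : exists2 D, I D &
  forall j y, j \in K -> ~ D y -> closing_family j y = E j y.
Proof.
have [I0 _ IU] := I_ideal.
elim: K => [|i K [D ID DP]]; first by exists set0.
exists (D `|` if `[< I i.1 >] then i.1 `|` [set i.2] else set0).
  by apply: (IU) => //; case: asboolP => // Ii; exact: IU.
move=> j y; rewrite inE => /orP[/eqP ->|jK] nDy; last first.
  by apply: DP => // Dy; apply: nDy; left.
rewrite /closing_family /=; case: ifPn => // Ii; apply/propext; split.
  by case=> [yi|[]//]; case: nDy; right; rewrite Ii; right.
by move=> Eiy; right; split=> // iy; apply: nDy; right; rewrite Ii; left.
Qed.

Lemma closing_family_independent : independent_mod closing_family I.
Proof.
have [_ IS IU] := I_ideal.
move=> g K IK; have [D ID DP] := closing_family_modI K.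
apply: (E_indep (g := g) (K := K)); apply: IS (IU _ _ IK ID) => y Ky.
have [Dy|nDy] := pselect (D y); [by right|left] => j jK.
by rewrite DP// Ky.
Qed.

Lemma open_notin_ideal (U : set X) : open U -> U !=set0 -> ~ I U.
Proof.
have [_ IS _] := I_ideal.
move=> oU [x Ux] IU; have [K KU] := oU x Ux.
exact: (closing_family_independent (IS _ _ KU IU)).
Qed.

(** If [x] is outside [A], then [closing_family (A, x)] is a neighbourhood of [x] missing [A]. *)
Lemma closed_ideal (A : set X) : I A -> closed A.
Proof.
move=> IA x clx; apply: contrapT => nAx.
have [|y [Ay]] := clx (closing_family (A, x)); last first.
  rewrite /closing_family /=; case: asboolP => // _ [yx|[]//].
  by apply: nAx; rewrite -yx.
apply: open_nbhs_nbhs; split; first exact: open_generator.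
by rewrite /closing_family /=; case: asboolP => // _; left.
Qed.

Lemma empty_interior_ideal (N : set X) : N° = set0 -> I N.
Proof.
have [_ IS IU] := I_ideal.
move=> N0; apply: contrapT => /I_max[g [K IKN]].
have [D ID DP] := closing_family_modI K.
have IZ : I (cell closing_family g K `\` N).
  apply: IS (IU _ _ IKN ID) => y [Ky Ny].
  have [Dy|nDy] := pselect (D y); [by right|left] => //.
  by split=> // j jK; rewrite -DP// Ky.
(* The part of the cell outside [N] is in [I], hence closed, so the part inside [N] is open. It is
   then empty, which puts the whole cell in [I]. *)
have oKN : open (cell closing_family g K `&` N : set X).
  have -> : cell closing_family g K `&` N =
      cell closing_family g K `&` ~` (cell closing_family g K `\` N).
    by rewrite -setDE setDD.
  by apply: openI; [exact: open_cell|apply: closed_openC; exact: closed_ideal].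
apply: (closing_family_independent (g := g) (K := K)).
apply: IS IZ => y Ky; split=> // Ny.
suff : N° y by rewrite N0.
by apply: filterS (open_nbhs_nbhs (conj oKN _)) => // z [].
Qed.

Lemma closing_family_accessible : accessible_space X.
Proof.
move=> x y xy; exists (~` [set y]); split.
- by apply: closed_openC; apply: closed_ideal; exact: I_set1.
- by rewrite inE /=; exact/eqP.
- by rewrite setCK inE.
Qed.

Lemma closing_family_whyburn : whyburn_space X.
Proof.
apply: whyburn_of_closed_empty_interior; first exact: clopen_space_regular.
by move=> A /empty_interior_ideal; exact: closed_ideal.
Qed.

Lemma dense_setC_ideal (A : set X) : I A -> dense (~` A).
Proof.
have [_ IS _] := I_ideal.
move=> IA U U0 oU; apply: contrapT => /nonemptyPn UA.
apply: (open_notin_ideal oU U0); apply: IS IA => x Ux.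
by apply: contrapT => nAx; rewrite -[False]/(set0 x) -UA.
Qed.

Lemma ideal_not_dense (A : set X) : I A -> ~ dense A.
Proof.
have [_ IS IU] := I_ideal.
move=> IA dA; have : ~ I setT.
  by move/(IS (cell E setT [::])) => IT; apply: (E_indep (IT _)).
have [[x nAx] _|/nonemptyPn A0] := pselect (~` A !=set0).
  have [||y []//] := dA (~` A); first by exists x.
  by apply: closed_openC; exact: closed_ideal.
by apply; apply: IS IA => x _; apply: contrapT => nAx; rewrite -[False]/(set0 x) -A0.
Qed.

End ClosedIdeal.

(** * Continuum many independent sets on a countable set *)

(* A point [(n, S)] prescribes the truth value of the sets coded by [(A, k)]
   according to the first [n] bits of [A]. *)
Definition pattern : countType := (nat * seq (seq bool * nat))%type.

Section IndependentFamily.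
Context (X : countType).

Definition bits (A : set X) (i : nat) : bool :=
  if unpickle i is Some x then `[< A x >] else false.

(** This is the Fichtenholz-Kantorovich-Hausdorff independent family. *)
Definition pattern_family (j : set X * X) : set pattern :=
  [set t | (mkseq (bits j.1) t.1, pickle j.2) \in t.2].

(** Allowing every [m] past [n] lets one length serve finitely many pairs. *)
Lemma bits_separated (A B : set X) : exists n,
  forall m, (n <= m)%N -> mkseq (bits A) m = mkseq (bits B) m -> A = B.
Proof.
have [->|AB] := pselect (A = B); first by exists 0%N.
have [x ABx] : exists x, A x <> B x.
  apply: contrapT => noX; apply: AB; apply/funext => x.
  by apply: contrapT => ABx; apply: noX; exists x.
exists (pickle x).+1 => m xm /(congr1 (nth false ^~ (pickle x))).
rewrite !nth_mkseq// /bits pickleK => ABx'.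
by case: ABx; apply/propext; rewrite -(asboolE (A x)) ABx' asboolE.
Qed.

Lemma pattern_family_surj g K : exists t, cell pattern_family g K t.
Proof.
have [d dP] := choice (fun p : set X * set X => bits_separated p.1 p.2).
(* Prefixes of length [n] separate all first components in [K]; the list then holds the codes of the
   indices that [g] makes true. *)
pose n := (\max_(p <- [seq (i.1, j.1) | i <- K, j <- K]) d p)%N.
exists (n, [seq (mkseq (bits i.1) n, pickle i.2) | i <- K & `[< g i >]]).
move=> j jK; rewrite /pattern_family /=; apply/propext; split.
  move=> /mapP[i]; rewrite mem_filter => /andP[/asboolP gi iK] [ij1 ij2].
  have -> : j = i; last exact: gi.
  have ij : j.1 = i.1.
    apply: (dP (j.1, i.1) n _ ij1).
    by apply: leq_bigmax_seq => //; apply/allpairsP; exists (j, i).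
  by rewrite [j]surjective_pairing ij (pcan_inj pickleK ij2) -surjective_pairing.
move=> gj; apply/mapP; exists j => //.
by rewrite mem_filter jK andbT; exact/asboolP.
Qed.

End IndependentFamily.

(** * The countable carrier and its initial ideal *)

(* The point [(t, m, k)] is the one of height [k] in the copy of [t] lying in
   the fibre over [m]. *)
Definition carrier : countType := (pattern * nat * nat)%type.

Definition carrier_family (j : set carrier * carrier) : set carrier :=
  [set x | pattern_family j x.1.1].

(** The ideal Fin x Fin on the coordinates [(m, k)], pulled back to the carrier. Patterns are
    ignored, so no full copy of [nat * nat] over one pattern belongs to it. *)
Definition carrier_ideal : set (set carrier) :=
  [set A | exists n (h : nat -> nat),
    forall x, A x -> (x.1.2 < n) || (x.2 < h x.1.2)].

Lemma carrier_ideal_is_ideal : is_ideal carrier_ideal.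
Proof.
split; first by exists 0%N, (fun=> 0%N).
  by move=> A B AB [n [h nhB]]; exists n, h => x /AB; exact: nhB.
move=> A B [n [h nhA]] [m [k mkB]].
exists (maxn n m), (fun i => maxn (h i) (k i)) => x.
by rewrite !leq_max => -[/nhA|/mkB] /orP[] ->; rewrite ?orbT.
Qed.

Lemma carrier_family_independent : independent_mod carrier_family carrier_ideal.
Proof.
move=> g K [n [h nhK]]; have [t Kt] := pattern_family_surj g K.
(* This point escapes both bounds: its fibre is not below [n], its height not below [h n]. *)
by have := nhK (t, n, h n); rewrite /= !ltnn => /(_ Kt).
Qed.

Lemma carrier_ideal_set1 x : carrier_ideal [set x].
Proof. by exists x.1.2.+1, (fun=> 0%N) => y ->; rewrite ltnSn. Qed.

Lemma carrier_ideal_fibres n : carrier_ideal [set x | (x.1.2 < n)%N].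
Proof. by exists n, (fun=> 0%N) => x /= ->. Qed.

Lemma carrier_ideal_bigcup (F : nat -> set carrier) :
  (forall n, finite_set (F n)) ->
  (forall n, F n `<=` ~` [set x | (x.1.2 < n)%N]) ->
  carrier_ideal (\bigcup_n F n).
Proof.
move=> finF Fge.
have /choice[b bP] n : exists b, forall x, F n x -> (x.2 < b)%N.
  have /finite_seqP[s ->] := finF n; exists (\max_(x <- s) x.2).+1 => x xs.
  by rewrite ltnS; exact: leq_bigmax_seq.
(* Only [F 0], ..., [F m] can meet the fibre over [m]. *)
exists 0%N, (fun m => \max_(n < m.+1) b n)%N => x [n _ Fx].
have nx : (n < x.1.2.+1)%N by rewrite ltnS leqNgt; apply/negP; exact: Fge Fx.
apply: (leq_trans (bP _ _ Fx)).
exact: (leq_bigmax (Ordinal nx)).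
Qed.

Theorem corollary13 :
  exists X : topologicalType,
    countable [set: X]%classic /\
    regular_T1_space X /\
    whyburn_space X /\
    ~ selectively_separable X.
Proof.
have [I [I0I idI indI maxI]] := maximal_independence_ideal
  carrier_ideal_is_ideal carrier_family_independent.
have I1 x : I [set x] by apply: I0I; exact: carrier_ideal_set1.
exists (clopen_space (closing_family carrier_family I)); split.
  exact: (@countableP carrier).
split; first split.
- exact: closing_family_accessible.
- exact: clopen_space_regular.
split; first exact: closing_family_whyburn.
move=> /(_ (fun n => ~` [set x : carrier | (x.1.2 < n)%N]))[n|F [FP dF]].
  by apply: (dense_setC_ideal idI I1 indI); apply: I0I; exact: carrier_ideal_fibres.
apply: (ideal_not_dense idI indI _ dF); apply: I0I.
by apply: carrier_ideal_bigcup => n; have [] := FP n.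
Qed.
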